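(* Any parabolic soliton of the inverse curve shortening flow in $\mathbb{H}^2$ is a graph on the $y$-axis, i.e. it can be written in the form $x=x(y)$.
   Context: $\mathbb{H}^2$ is the upper half-plane $\{(x,y)\in\mathbb{R}^2: y>0\}$ with metric $(dx^2+dy^2)/y^2$. For a regular curve $\gamma\colon I\to\mathbb{H}^2$, $\gamma=(x,y)$, $I$ an interval, the unit normal is $N=y\,(-y',x')/\sqrt{x'^2+y'^2}$ and the hyperbolic curvature is $\kappa=y\kappa_e+x'/\sqrt{x'^2+y'^2}$, where $\kappa_e=(x'y''-x''y')/(x'^2+y'^2)^{3/2}$. A parabolic soliton of the inverse curve shortening flow is a curve satisfying $1/\kappa=-\langle N,\partial_x\rangle$ (in particular $\kappa\neq0$). When $\gamma$ is parametrized by Euclidean arc length with $x'=\cos\theta$, $y'=\sin\theta$, this is equivalent to $\theta'=\frac{1}{\sin\theta}-\frac{\cos\theta}{y}$. *)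

(* Defs.v *)
From Stdlib Require Export Reals.

Open Scope R_scope.

(** The half-plane is the set of pairs [(x, y) : R * R] with [0 < y]; tangent
    vectors at any of its points are pairs in the coordinate frame
    [(d/dx, d/dy)]. *)
Definition upper_half_plane (p : R * R) : Prop := 0 < snd p.

(** The inner product at [p] of the metric [(dx^2 + dy^2) / y^2]. *)
Definition hyp_inner (p u v : R * R) : R :=
  (fst u * fst v + snd u * snd v) / (snd p) ^ 2.

Definition partial_x : R * R := (1, 0).

Definition speed (x' y' : R) : R := sqrt (x' ^ 2 + y' ^ 2).

Definition unit_normal (y x' y' : R) : R * R :=
  (y * (- y' / speed x' y'), y * (x' / speed x' y')).

Definition euclidean_curvature (x' y' x'' y'' : R) : R :=
  (x' * y'' - x'' * y') / (speed x' y') ^ 3.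

Definition hyperbolic_curvature (y x' y' x'' y'' : R) : R :=
  y * euclidean_curvature x' y' x'' y'' + x' / speed x' y'.

(** Intervals of any kind, bounded or not, open, closed or half-open, but not
    empty or reduced to a point (differentiation would then be vacuous). *)
Definition is_interval (I : R -> Prop) : Prop :=
  (forall a b t, I a -> I b -> a <= t <= b -> I t) /\
  (exists a b, I a /\ I b /\ a < b).

(** [D_in f f' I t] is differentiability relative to [I], hence one-sided at an
    endpoint belonging to [I]. The values of functions outside [I] are
    irrelevant. *)
Definition derivative_on (I : R -> Prop) (f f' : R -> R) : Prop :=
  forall t, I t -> D_in f f' I t.

Definition C2_on (I : R -> Prop) (f f' f'' : R -> R) : Prop :=
  derivative_on I f f' /\ derivative_on I f' f'' /\
  (forall t, I t -> continue_in f'' I t).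

(** The curve [t |-> (x t, y t)], [t] in [I]. The derivatives are determined on
    [I] by [x] and [y], because [I] is not reduced to a point. *)
Definition parabolic_soliton (I : R -> Prop) (x y : R -> R) : Prop :=
  exists x' y' x'' y'' : R -> R,
    C2_on I x x' x'' /\ C2_on I y y' y'' /\
    forall t, I t ->
      let kappa := hyperbolic_curvature (y t) (x' t) (y' t) (x'' t) (y'' t) in
      let N := unit_normal (y t) (x' t) (y' t) in
      upper_half_plane (x t, y t) /\
      (x' t, y' t) <> (0, 0) /\
      kappa <> 0 /\
      1 / kappa = - hyp_inner (x t, y t) N partial_x.

(** The trace of the curve is the graph [x = f(y)] of a function [f] of class
    C^2 on an interval [J] of the [y]-axis. *)
Definition graph_on_y_axis (I : R -> Prop) (x y : R -> R) : Prop :=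
  exists (J : R -> Prop) (f f' f'' : R -> R),
    is_interval J /\ C2_on J f f' f'' /\
    forall p : R * R,
      (exists t, I t /\ p = (x t, y t)) <-> (exists s, J s /\ p = (f s, s)).

(* Main.v *)
(** The right-hand side of the soliton equation is [y' / (y * speed x' y')],
    while the left-hand side [1 / kappa] never vanishes; hence [y'] has no zero
    and, by continuity, constant sign. So [y] is strictly monotone and
    [x = x(y)] is obtained by composing [x] with the inverse of [y], the chain
    rule giving the regularity. *)

Require Import Defs.
From Stdlib Require Import Reals Lra ClassicalEpsilon.

(** * Mean and intermediate values relative to an interval *)

Lemma continue_in_elim (f : R -> R) (I : R -> Prop) (t0 eps : R) :
  continue_in f I t0 -> 0 < eps ->
  exists d, 0 < d /\
    forall t, I t -> Rabs (t - t0) < d -> Rabs (f t - f t0) < eps.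
Proof.
  intros Hc He.
  destruct (Hc eps He) as [d [Hd H]].
  exists d; split; [exact Hd |].
  intros t It Ht.
  (* [continue_in] is a punctured limit, so the centre [t0] is treated apart. *)
  destruct (Req_dec t0 t) as [<- | Hne].
  - now rewrite Rminus_diag, Rabs_R0.
  - apply (H t). repeat split; assumption.
Qed.

(** The retraction of the line onto [[a, b]]. Composing with it turns a function controlled only on
    the interval into one continuous on all of [R], to which the classical theorems apply. *)
Definition clamp (a b t : R) : R := Rmax a (Rmin b t).

Lemma clamp_bounds (a b t : R) : a <= b -> a <= clamp a b t <= b.
Proof.
  intros; unfold clamp, Rmax, Rmin; repeat destruct Rle_dec; lra.
Qed.

Lemma clamp_id (a b t : R) : a <= t <= b -> clamp a b t = t.
Proof.
  intros; unfold clamp, Rmax, Rmin; repeat destruct Rle_dec; lra.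
Qed.

Lemma clamp_lipschitz (a b s t : R) :
  a <= b -> Rabs (clamp a b s - clamp a b t) <= Rabs (s - t).
Proof.
  intros; unfold clamp, Rmax, Rmin, Rabs.
  repeat destruct Rle_dec; repeat destruct Rcase_abs; lra.
Qed.

Lemma clamp_continuity (f : R -> R) (I : R -> Prop) (a b : R) :
  is_interval I -> I a -> I b -> a <= b ->
  (forall t, I t -> continue_in f I t) ->
  continuity (fun t => f (clamp a b t)).
Proof.
  intros [HI _] Ia Ib Hab Hf t eps He.
  assert (Ic : forall u, I (clamp a b u))
    by (intro u; exact (HI a b _ Ia Ib (clamp_bounds a b u Hab))).
  destruct (continue_in_elim f I _ eps (Hf _ (Ic t)) He) as [d [Hd H]].
  exists d; split; [exact Hd |].
  intros u [_ Hu].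
  apply H; [apply Ic |].
  eapply Rle_lt_trans; [now apply clamp_lipschitz | exact Hu].
Qed.

(** An increment shorter than the distance from [t] to both endpoints stays where [clamp] is the
    identity, so the relative derivative becomes a two-sided one. *)
Lemma clamp_derivable_pt_lim (f f' : R -> R) (I : R -> Prop) (a b t : R) :
  is_interval I -> I a -> I b -> a < t < b -> derivative_on I f f' ->
  derivable_pt_lim (fun t => f (clamp a b t)) t (f' t).
Proof.
  intros [HI _] Ia Ib Ht Hf eps He.
  assert (It : I t) by (apply (HI a b); trivial; lra).
  destruct (Hf t It eps He) as [d [Hd H]].
  assert (Hm : 0 < Rmin d (Rmin (t - a) (b - t)))
    by (repeat apply Rmin_glb_lt; lra).
  exists (mkposreal _ Hm); intros h Hh0 Hh; simpl in Hh.
  assert (Hh1 : Rabs h < d)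
    by (eapply Rlt_le_trans; [exact Hh | apply Rmin_l]).
  assert (Hh2 : Rabs h < t - a)
    by (eapply Rlt_le_trans;
        [exact Hh | eapply Rle_trans; [apply Rmin_r | apply Rmin_l]]).
  assert (Hh3 : Rabs h < b - t)
    by (eapply Rlt_le_trans;
        [exact Hh | eapply Rle_trans; [apply Rmin_r | apply Rmin_r]]).
  apply Rabs_def2 in Hh2; apply Rabs_def2 in Hh3.
  rewrite !clamp_id by lra.
  specialize (H (t + h)); simpl in H; unfold Rdist in H.
  replace (t + h - t) with h in H by ring.
  apply H; repeat split; trivial; [apply (HI a b); trivial |]; lra.
Qed.

Lemma mean_value_on (f f' : R -> R) (I : R -> Prop) (a b : R) :
  is_interval I -> derivative_on I f f' -> I a -> I b -> a < b ->
  exists c, I c /\ f b - f a = f' c * (b - a).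
Proof.
  intros HI Hf Ia Ib Hab.
  set (g := fun t => f (clamp a b t)).
  assert (Hg : forall c, a < c < b -> derivable_pt_lim g c (f' c))
    by (intros c Hc; now apply (clamp_derivable_pt_lim f f' I)).
  assert (Hgc : continuity g).
  { apply (clamp_continuity f I); trivial; [lra |].
    intros t It; exact (cont_deriv f f' I t (Hf t It)). }
  (* Cauchy's form, with the identity as second function. The derivability proofs are explicit
     terms, so that [derive_pt] computes to [f' c]. *)
  destruct (MVT g id a b
              (fun c Hc => exist _ (f' c) (Hg c Hc))
              (fun c _ => derivable_pt_id c) Hab
              (fun c _ => Hgc c)
              (fun c _ => derivable_continuous_pt id c (derivable_pt_id c)))
    as [c [Hc E]].
  exists c; split.
  - destruct HI as [HI _]; apply (HI a b); trivial; lra.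
  - rewrite derive_pt_id in E.
    replace (derive_pt g c (exist _ (f' c) (Hg c Hc))) with (f' c) in E
      by reflexivity.
    unfold g, id in E; rewrite !clamp_id in E by lra; lra.
Qed.

Lemma intermediate_value_on (f : R -> R) (I : R -> Prop) (a b v : R) :
  is_interval I -> (forall t, I t -> continue_in f I t) -> I a -> I b ->
  (f a - v) * (f b - v) <= 0 -> exists c, I c /\ f c = v.
Proof.
  intros HI Hf.
  enough (W : forall a b, I a -> I b -> a <= b ->
            (f a - v) * (f b - v) <= 0 -> exists c, I c /\ f c = v).
  { intros Ia Ib Hv; destruct (Rle_dec a b).
    - now apply (W a b).
    - apply (W b a); trivial; lra. }
  clear a b; intros a b Ia Ib Hab Hv.
  assert (Hc : continuity (fun t => f (clamp a b t) - v)).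
  { apply (continuity_minus (fun t => f (clamp a b t)) (fun _ => v)).
    - now apply (clamp_continuity f I).
    - apply continuity_const; intros ? ?; reflexivity. }
  destruct (IVT_cor _ a b Hc Hab) as [c [Hcab E]].
  - now rewrite !clamp_id by lra.
  - exists c; split.
    + destruct HI as [HI _]; now apply (HI a b).
    + rewrite clamp_id in E by lra; lra.
Qed.

Lemma nonvanishing_same_sign (g : R -> R) (I : R -> Prop) (a b : R) :
  is_interval I -> (forall t, I t -> continue_in g I t) ->
  (forall t, I t -> g t <> 0) -> I a -> I b -> 0 < g a * g b.
Proof.
  intros HI Hg Hnz Ia Ib.
  destruct (Rlt_dec 0 (g a * g b)) as [H | H]; trivial.
  destruct (intermediate_value_on g I a b 0 HI Hg Ia Ib) as [c [Ic E]]; [lra |].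
  now destruct (Hnz c Ic).
Qed.

(** * Algebra of relative limits and the quotient rule *)

Lemma continue_in_mult (f g : R -> R) (D : R -> Prop) (t : R) :
  continue_in f D t -> continue_in g D t ->
  continue_in (fun s => f s * g s) D t.
Proof. exact (limit_mul f g (D_x D t) (f t) (g t) t). Qed.

Lemma continue_in_minus (f g : R -> R) (D : R -> Prop) (t : R) :
  continue_in f D t -> continue_in g D t ->
  continue_in (fun s => f s - g s) D t.
Proof. exact (limit_minus f g (D_x D t) (f t) (g t) t). Qed.

Lemma continue_in_div (f g : R -> R) (D : R -> Prop) (t : R) :
  continue_in f D t -> continue_in g D t -> g t <> 0 ->
  continue_in (fun s => f s / g s) D t.
Proof.
  intros Hf Hg Hg0.
  exact (limit_mul _ _ _ _ _ _ Hf (limit_inv _ _ _ _ Hg Hg0)).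
Qed.

Lemma limit1_in_const (c : R) (D : R -> Prop) (t : R) :
  limit1_in (fun _ => c) D c t.
Proof.
  intros eps He; exists 1; split; [lra |].
  intros s _; simpl; now rewrite Rdist_eq.
Qed.

Lemma D_in_div (u u' v v' : R -> R) (I : R -> Prop) (t : R) :
  I t -> (forall s, I s -> v s <> 0) -> D_in u u' I t -> D_in v v' I t ->
  D_in (fun s => u s / v s)
    (fun s => (u' s * v s - u s * v' s) / (v s * v s)) I t.
Proof.
  intros It Hnz Hu Hv'.
  assert (Hv := Hnz t It).
  assert (Lv : limit1_in v (D_x I t) (v t) t) by exact (cont_deriv v v' I t Hv').
  assert (Lc : forall c, limit1_in (fun _ => c) (D_x I t) c t)
    by (intro c; apply limit1_in_const).
  unfold D_in.
  replace ((u' t * v t - u t * v' t) / (v t * v t))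
    with ((u' t * v t - u t * v' t) * (/ v t * / v t)) by (field; exact Hv).
  intros eps He.
  (* The difference quotient of [u / v] is that of [u] times [v t], minus [u t] times that of [v],
     all multiplied by [/ v s * / v t]; each factor has a known limit. *)
  destruct (limit_mul _ _ _ _ _ _
     (limit_minus _ _ _ _ _ _
       (limit_mul _ _ _ _ _ _ Hu (Lc (v t)))
       (limit_mul _ _ _ _ _ _ (Lc (u t)) Hv'))
     (limit_mul _ _ _ _ _ _ (limit_inv _ _ _ _ Lv Hv) (Lc (/ v t))) eps He)
    as [d [Hd H]].
  exists d; split; [exact Hd |].
  intros s [[Is Hs] Hsd].
  specialize (H s (conj (conj Is Hs) Hsd)); simpl in H |- *.
  match goal with |- Rdist ?p _ < _ =>
    match type of H with Rdist ?q _ < _ => replace p with q; [exact H |] end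
  end.
  field; repeat split; trivial; [now apply Hnz | lra].
Qed.

(** * Inverting [y] and passing to it as parameter *)

Section Reparametrization.

Variables (I : R -> Prop) (y y' : R -> R).
Hypothesis HI : is_interval I.
Hypothesis Hy : derivative_on I y y'.
Hypothesis Hy'c : forall t, I t -> continue_in y' I t.
Hypothesis Hy'0 : forall t, I t -> y' t <> 0.

Let J (s : R) : Prop := exists t, I t /\ y t = s.

(** The inverse of [y], obtained by choice; its values outside [J] are arbitrary. *)
Let h (s : R) : R := epsilon (inhabits 0) (fun t => I t /\ y t = s).

Let h_spec (s : R) : J s -> I (h s) /\ y (h s) = s.
Proof. exact (epsilon_spec (inhabits 0) (fun t => I t /\ y t = s)). Qed.

Let y_neq (a b : R) : I a -> I b -> a < b -> y a <> y b.
Proof.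
  intros Ia Ib Hab E.
  destruct (mean_value_on y y' I a b HI Hy Ia Ib Hab) as [c [Ic Ec]].
  apply (Hy'0 c Ic), (Rmult_eq_reg_r (b - a)); lra.
Qed.

Let y_inj (a b : R) : I a -> I b -> y a = y b -> a = b.
Proof.
  intros Ia Ib E.
  destruct (Rtotal_order a b) as [H | [H | H]]; trivial; exfalso.
  - now apply (y_neq a b).
  - now apply (y_neq b a).
Qed.

Let h_left_inverse (t : R) : I t -> h (y t) = t.
Proof.
  intros It.
  destruct (h_spec (y t)) as [Ih E]; [now exists t |].
  now apply y_inj.
Qed.

(** Strict monotonicity in a form that covers the increasing and the decreasing case at once: by the
    mean value theorem both increments carry a value of [y'], and these values have the same
    sign. *)
Let y_between (a b c : R) :
  I a -> I b -> I c -> a < b < c -> 0 < (y b - y a) * (y c - y b).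
Proof.
  intros Ia Ib Ic [Hab Hbc].
  destruct (mean_value_on y y' I a b HI Hy Ia Ib Hab) as [p [Ip ->]].
  destruct (mean_value_on y y' I b c HI Hy Ib Ic Hbc) as [q [Iq ->]].
  replace (y' p * (b - a) * (y' q * (c - b)))
    with (y' p * y' q * ((b - a) * (c - b))) by ring.
  apply Rmult_lt_0_compat; [now apply (nonvanishing_same_sign y' I) |].
  apply Rmult_lt_0_compat; lra.
Qed.

(** The source of the continuity of the inverse: by monotonicity, parameters at or beyond [b] have
    images at least as far from [y t0] as [y b] is. If [b] is not in [I], no parameter lies beyond
    it, and any positive [d] serves. *)
Let y_far (t0 b : R) :
  I t0 -> t0 <> b ->
  exists d, 0 < d /\
    forall t, I t -> (t0 < b <= t \/ t <= b < t0) -> d <= Rabs (y t - y t0).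
Proof.
  intros I0 Hb.
  destruct (excluded_middle_informative (I b)) as [Ib | Nb].
  - exists (Rabs (y b - y t0)); split.
    + apply Rabs_pos_lt; intro E.
      apply Hb, y_inj; trivial; lra.
    + intros t It Ht.
      destruct (Req_dec b t) as [<- | Hbt]; [lra |].
      assert (P : 0 < (y b - y t0) * (y t - y b)).
      { destruct Ht as [Ht | Ht].
        - apply y_between; trivial; lra.
        - replace ((y b - y t0) * (y t - y b))
            with ((y b - y t) * (y t0 - y b)) by ring.
          apply y_between; trivial; lra. }
      (* Squares are compared: in the expansion around [y b], the cross term is positive by [P]. *)
      apply Rsqr_le_abs_0; unfold Rsqr.
      assert (0 <= (y t - y b) * (y t - y b)) by apply Rle_0_sqr.
      replace ((y t - y t0) * (y t - y t0)) with
        ((y b - y t0) * (y b - y t0) + 2 * ((y b - y t0) * (y t - y b))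
         + (y t - y b) * (y t - y b)) by ring.
      lra.
  - exists 1; split; [lra |].
    intros t It Ht; exfalso; apply Nb.
    destruct HI as [HI' _], Ht as [Ht | Ht].
    + apply (HI' t0 t); trivial; lra.
    + apply (HI' t t0); trivial; lra.
Qed.

(** Change of variable [s = y t] in a limit. Were [h s] at or beyond [t0 + d / 2] or [t0 - d / 2],
    [y_far] would keep [s] at distance [d1] or [d2] from [y t0]. Moreover [h s] differs from [t0]
    when [s] differs from [y t0], as the punctured limit requires. *)
Let h_limit (G : R -> R) (l t0 : R) :
  I t0 -> limit1_in G (D_x I t0) l t0 ->
  limit1_in (fun s => G (h s)) (D_x J (y t0)) l (y t0).
Proof.
  intros I0 HG eps He.
  destruct (HG eps He) as [d [Hd H]].
  destruct (y_far t0 (t0 + d / 2)) as [d1 [Hd1 H1]]; [trivial | lra |].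
  destruct (y_far t0 (t0 - d / 2)) as [d2 [Hd2 H2]]; [trivial | lra |].
  exists (Rmin d1 d2); split; [now apply Rmin_glb_lt |].
  intros s [[Js Hs] Hsd]; simpl in Hsd; unfold Rdist in Hsd.
  destruct (h_spec s Js) as [Ih Eh].
  assert (Rmin d1 d2 <= d1) by apply Rmin_l.
  assert (Rmin d1 d2 <= d2) by apply Rmin_r.
  apply H; repeat split; trivial.
  - intro E; apply Hs; now rewrite E.
  - simpl; unfold Rdist; apply Rabs_def1.
    + destruct (Rlt_dec (h s) (t0 + d / 2)); [lra |].
      assert (K := H1 (h s) Ih); rewrite Eh in K; lra.
    + destruct (Rlt_dec (t0 - d / 2) (h s)); [lra |].
      assert (K := H2 (h s) Ih); rewrite Eh in K; lra.
Qed.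

Let h_continue_in (G : R -> R) (s : R) :
  J s -> continue_in G I (h s) -> continue_in (fun s => G (h s)) J s.
Proof.
  intros Js HG.
  destruct (h_spec s Js) as [Ih Eh].
  assert (K := h_limit G (G (h s)) (h s) Ih HG).
  now rewrite Eh in K.
Qed.

(** The difference quotient of [F] composed with [h] is the quotient of those of [F] and [y] at
    [t0], which tends to [F' t0 / y' t0]; [h_limit] transports this limit. *)
Let h_derivative_on (F F' : R -> R) :
  derivative_on I F F' ->
  derivative_on J (fun s => F (h s)) (fun s => F' (h s) / y' (h s)).
Proof.
  intros HF s [t0 [I0 <-]]; unfold D_in.
  rewrite (h_left_inverse t0 I0).
  assert (K := h_limit _ _ t0 I0
    (limit_mul _ _ _ _ _ _ (HF t0 I0) (limit_inv _ _ _ _ (Hy t0 I0) (Hy'0 t0 I0)))).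
  intros eps He; destruct (K eps He) as [d [Hd H]].
  exists d; split; [exact Hd |].
  intros s [[Js Hs] Hsd].
  specialize (H s (conj (conj Js Hs) Hsd)); simpl in H |- *.
  destruct (h_spec s Js) as [Ih Eh]; rewrite Eh in H.
  match goal with |- Rdist ?p _ < _ =>
    match type of H with Rdist ?q _ < _ => replace p with q; [exact H |] end
  end.
  field; repeat split; try lra.
  intro E; apply Hs; rewrite <- Eh; f_equal; lra.
Qed.

Lemma graph_of_nonvanishing_derivative (x x' x'' y'' : R -> R) :
  C2_on I x x' x'' -> C2_on I y y' y'' -> graph_on_y_axis I x y.
Proof.
  intros [Hx [Hx' Hx''c]] [_ [Hy' Hy''c]].
  (* The second derivative is the quotient rule for [x' / y'], divided once more by [y'] through the
     chain rule. *)
  exists J, (fun s => x (h s)), (fun s => x' (h s) / y' (h s)),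
    (fun s => (x'' (h s) * y' (h s) - x' (h s) * y'' (h s)) / (y' (h s) * y' (h s))
              / y' (h s)).
  split; [split | split; [split; [| split] |]].
  - intros a b v [ta [Ia <-]] [tb [Ib <-]] Hv.
    apply (intermediate_value_on y I ta tb); trivial.
    + intros t It; exact (cont_deriv y y' I t (Hy t It)).
    + assert (0 <= (v - y ta) * (y tb - v)) by (apply Rmult_le_pos; lra).
      lra.
  - destruct HI as [_ [a [b [Ia [Ib Hab]]]]].
    (* Since [y] may decrease, the two images are taken in whichever order is increasing. *)
    destruct (Rtotal_order (y a) (y b)) as [H | [H | H]].
    + exists (y a), (y b); repeat split; [now exists a | now exists b | exact H].
    + now destruct (y_neq a b).
    + exists (y b), (y a); repeat split; [now exists b | now exists a | exact H].
  - now apply h_derivative_on.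
  - apply (h_derivative_on (fun t => x' t / y' t)
             (fun t => (x'' t * y' t - x' t * y'' t) / (y' t * y' t))).
    intros t It; apply D_in_div; auto.
  - intros s Js.
    destruct (h_spec s Js) as [It _].
    apply (h_continue_in
      (fun t => (x'' t * y' t - x' t * y'' t) / (y' t * y' t) / y' t)); trivial.
    assert (Lx' : continue_in x' I (h s)) by exact (cont_deriv x' x'' I _ (Hx' _ It)).
    assert (Hnz := Hy'0 _ It).
    repeat first [ apply continue_in_div | apply continue_in_minus
                 | apply continue_in_mult ];
      auto using Rmult_integral_contrapositive_currified.
  - intro p; split.
    + intros [t [It ->]]; exists (y t); split; [now exists t |].
      now rewrite h_left_inverse.
    + intros [s [Js ->]]; destruct (h_spec s Js) as [It E].
      exists (h s); split; trivial; now rewrite E.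
Qed.

End Reparametrization.

(** * The soliton equation excludes horizontal tangents *)

Theorem proposition4p1 (I : R -> Prop) (x y : R -> R)
  (HI : is_interval I) (Hsol : parabolic_soliton I x y) :
  graph_on_y_axis I x y.
Proof.
  destruct Hsol as [x' [y' [x'' [y'' [Cx [Cy Heq]]]]]].
  assert (Hy'0 : forall t, I t -> y' t <> 0).
  { intros t It E.
    destruct (Heq t It) as [_ [_ [Hk Hs]]].
    (* The first component of the normal is a multiple of [y']: if [y' t = 0], the normal is
       orthogonal to [partial_x] and the equation gives [1 / kappa = 0], which is impossible. *)
    apply (Rinv_neq_0_compat _ Hk).
    rewrite <- Rdiv_1_l, Hs, E.
    unfold hyp_inner, unit_normal, partial_x, Rdiv; simpl; ring. }
  destruct Cy as [Hy [Hy' Hy'']].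
  apply (graph_of_nonvanishing_derivative I y y') with x' x'' y''; trivial.
  - intros t It; exact (cont_deriv y' y'' I t (Hy' t It)).
  - now repeat split.
Qed.
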